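(* For every integer $v\ge 2$ there exists a constant $C_v>0$, depending only on $v$, such that for every $W\in\mathcal W_v$, $$C_v\|W\|_{\square}\le \|W\|_{\square^*}\le \|W\|_{\square}.$$
   Context: $\mathcal W_v$ is the space of all real-valued functions $W\in L^1([0,1]^v)$ that are symmetric (invariant under all permutations of their $v$ arguments). For $W\in\mathcal W_v$, $$\|W\|_{\square^*}:=\sup_{S\subseteq[0,1]}\left|\int_{S^v}W(x_1,\ldots,x_v)\prod_{i=1}^v dx_i\right|,\qquad \|W\|_{\square}:=\sup_{S_1,\ldots,S_v\subseteq[0,1]}\left|\int_{S_1\times\cdots\times S_v}W(x_1,\ldots,x_v)\prod_{i=1}^v dx_i\right|,$$ where the suprema are over (Lebesgue) measurable subsets of $[0,1]$. *)

(* Defs.v *)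
From HB Require Import structures.
From mathcomp Require Import all_boot all_order all_algebra all_fingroup.
From mathcomp Require Import all_classical all_reals all_analysis.

Set Implicit Arguments.
Unset Strict Implicit.
Unset Printing Implicit Defensive.
Import Order.TTheory GRing.Theory Num.Theory.
Import numFieldNormedType.Exports.
Local Open Scope classical_set_scope.
Local Open Scope ring_scope.
Local Open Scope ereal_scope.

Definition tbox (T : Type) n (S : 'I_n -> set T) : set (n.-tuple T) :=
  [set x | forall i, S i (tnth x i)].

Section tcons.
Context d (T : measurableType d).

Definition tcons n (x : T * n.-tuple T) : n.+1.-tuple T :=
  [tuple of x.1 :: x.2].

Lemma measurable_tcons n : measurable_fun setT (@tcons n).
Proof. exact: (measurable_cons measurable_fst measurable_snd). Qed.

Lemma preimage_tcons n (A : set T) (B : set (n.-tuple T)) :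
  @tcons n @^-1` [set x | A (thead x) /\ B [tuple of behead x]] = A `*` B.
Proof.
apply/seteqP; split=> -[a b] /=; rewrite theadE.
  by move=> [? h]; split=> //=; rewrite (_ : b = [tuple of behead (a :: b)])//;
    apply/val_inj.
by move=> [? h]; split=> //; rewrite (_ : [tuple of _] = b)//; apply/val_inj.
Qed.

Lemma measurable_tbox n (S : 'I_n -> set T) :
  (forall i, measurable (S i)) -> measurable (tbox S).
Proof.
move=> mS; rewrite (_ : tbox S =
  \big[setI/setT]_(i < n) ((fun x : n.-tuple T => tnth x i) @^-1` S i)).
  apply: bigsetI_measurable => i _.
  by rewrite -[X in measurable X]setTI; exact: measurable_tnth.
apply/seteqP; split=> x.
  by move=> Sx; apply: (big_ind (fun A : set _ => A x)) => //;
    move=> i _; exact: Sx.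
move=> + i; rewrite (bigD1 i)//=; exact: proj1.
Qed.

End tcons.

Section tuple_measure_succ.
Context d (T : measurableType d) (R : realType) (n : nat).
Variables (m : {sigma_finite_measure set T -> \bar R})
  (mn : {sigma_finite_measure set (n.-tuple T) -> \bar R}).

Definition tuple_measure_succ : set (n.+1.-tuple T) -> \bar R :=
  pushforward (m \x mn) (@tcons _ T n).

Let tms0 : tuple_measure_succ set0 = 0.
Proof. by rewrite /tuple_measure_succ /pushforward preimage_set0 measure0. Qed.

Let tms_ge0 A : 0 <= tuple_measure_succ A.
Proof. by rewrite /tuple_measure_succ /pushforward; exact: measure_ge0. Qed.

Let tms_sigma_additive : semi_sigma_additive tuple_measure_succ.
Proof.
move=> F mF tF mUF; rewrite /tuple_measure_succ /pushforward preimage_bigcup.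
apply: measure_semi_sigma_additive.
- by move=> k; rewrite -[X in measurable X]setTI; exact: measurable_tcons.
- apply/trivIsetP => /= i j _ _ ij; rewrite -preimage_setI.
  by move/trivIsetP : tF => /(_ _ _ _ _ ij) ->//; rewrite preimage_set0.
- by rewrite -preimage_bigcup -[X in measurable X]setTI; exact: measurable_tcons.
Qed.

HB.instance Definition _ := isMeasure.Build _ _ _ tuple_measure_succ
  tms0 tms_ge0 tms_sigma_additive.

Lemma tuple_measure_succE (A : set T) (B : set (n.-tuple T)) :
  measurable A -> measurable B ->
  tuple_measure_succ [set x | A (thead x) /\ B [tuple of behead x]] = m A * mn B.
Proof.
move=> mA mB.
by rewrite /tuple_measure_succ /pushforward preimage_tcons product_measure1E.
Qed.

Let tms_sigma_finite : sigma_finite setT tuple_measure_succ.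
Proof.
have /sigma_finiteP[F [TF ndF Foo]] := sigma_finiteT m.
have /sigma_finiteP[G [TG ndG Goo]] := sigma_finiteT mn.
exists (fun k => [set x | F k (thead x) /\ G k [tuple of behead x]]).
  apply/esym; rewrite -subTset => x _.
  have [i _ Fi] : (\bigcup_i F i) (thead x) by rewrite -TF.
  have [j _ Gj] : (\bigcup_i G i) [tuple of behead x] by rewrite -TG.
  exists (maxn i j) => //; split.
  - by move: Fi; exact/subsetPset/ndF/leq_maxl.
  - by move: Gj; exact/subsetPset/ndG/leq_maxr.
move=> k; have [? ?] := Foo k; have [? ?] := Goo k; split.
  apply: (@measurableI _ _ (@thead n T @^-1` F k)
    ((fun x : n.+1.-tuple T => [tuple of behead x]) @^-1` G k)).
    by rewrite -[X in measurable X]setTI; exact: measurable_tnth.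
  by rewrite -[X in measurable X]setTI; exact: measurable_behead.
by rewrite tuple_measure_succE// lte_mul_pinfty// ge0_fin_numE.
Qed.

HB.instance Definition _ := Measure_isSigmaFinite.Build _ _ _
  tuple_measure_succ tms_sigma_finite.

End tuple_measure_succ.

Section tuple_measure.
Context d (T : measurableType d) (R : realType).
Variable m : {sigma_finite_measure set T -> \bar R}.

Fixpoint tuple_measure n : {sigma_finite_measure set (n.-tuple T) -> \bar R} :=
  match n with
  | 0 => \d_[tuple]
  | n.+1 => tuple_measure_succ m (tuple_measure n)
  end.

Lemma tuple_measure_tbox n (S : 'I_n -> set T) :
  (forall i, measurable (S i)) ->
  tuple_measure n (tbox S) = \prod_(i < n) m (S i).
Proof.
elim: n S => [|n IH] S mS.
  by rewrite big_ord0 /= diracE mem_set//; case.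
rewrite big_ord_recl /= -IH//.
rewrite -tuple_measure_succE//; last exact: measurable_tbox.
congr (tuple_measure_succ _ _ _); apply/seteqP; split=> x /=.
  move=> Sx; split; first exact: Sx.
  by move=> i /=; rewrite tnth_behead (_ : inord _ = lift ord0 i)//;
    apply/val_inj; rewrite /= inordK// ltnS.
move=> [S0 Sl] i; have [->//|i0] := eqVneq i ord0.
have [j ->] : exists j, i = lift ord0 j.
  by case: (unliftP ord0 i) i0 => [j -> _|->]; [exists j|rewrite eqxx].
have := Sl j; rewrite tnth_behead (_ : inord _ = lift ord0 j)//.
by apply/val_inj; rewrite /= inordK// ltnS.
Qed.

End tuple_measure.

Section lebesgue_measure_tuple.
Context (R : realType) (n : nat).

Let borel_measure : {measure set (n.-tuple (measurableTypeR R)) -> \bar R} :=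
  tuple_measure (@lebesgue_measure R) n.

(* Completion of the n-fold product of the Borel Lebesgue measure: the
   measurable sets are all the Lebesgue-measurable subsets of R^n. *)
Definition lebesgue_measure_tuple :
    set (caratheodory_type (borel_measure^*)%mu) -> \bar R :=
  @completed_measure_extension _ _ _ borel_measure.

HB.instance Definition _ := Measure.on lebesgue_measure_tuple.

Let sigma_finite_lebesgue_measure_tuple :
  sigma_finite setT lebesgue_measure_tuple.
Proof.
exact/completed_measure_extension_sigma_finite/sigma_finiteT.
Qed.

HB.instance Definition _ := Measure_isSigmaFinite.Build _ _ _
  lebesgue_measure_tuple sigma_finite_lebesgue_measure_tuple.

Lemma lebesgue_measure_tuple_is_complete :
  measure_is_complete lebesgue_measure_tuple.
Proof. exact: measure_is_complete_caratheodory. Qed.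

Lemma lebesgue_measure_tuple_tbox (S : 'I_n -> set (measurableTypeR R)) :
  (forall i, measurable (S i)) ->
  lebesgue_measure_tuple (tbox S) = \prod_(i < n) lebesgue_measure (S i).
Proof.
move=> mS; rewrite -tuple_measure_tbox//.
by apply: measurable_mu_extE; exact: measurable_tbox.
Qed.

End lebesgue_measure_tuple.
Arguments lebesgue_measure_tuple {R} n.

Section cut_norms.
Context (R : realType) (v : nat).
Implicit Types W : v.-tuple R -> R.

(* The sigma-algebra on which [completed_lebesgue_measure] is defined. *)
Definition lebesgue_measurable (S : set R) : Prop :=
  ((wlength (R := R) idfun)^*)%mu.-cara.-measurable S.

Definition unit_itv : set R := `[0%R, 1%R].

Definition unit_cube : set (v.-tuple R) := tbox (fun=> unit_itv).

Definition permute_args (s : 'S_v) (x : v.-tuple R) : v.-tuple R :=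
  [tuple tnth x (s i) | i < v].

(* A function on [0,1]^v is given by a function on R^v whose values outside
   the cube are irrelevant. As for any element of L^1, symmetry is an
   almost everywhere property. *)
Definition symmetric_L1 W : Prop :=
  (lebesgue_measure_tuple v).-integrable unit_cube (EFin \o W) /\
  forall s : 'S_v, {ae lebesgue_measure_tuple v, forall x,
    unit_cube x -> W (permute_args s x) = W x}.

Definition box_integral W (S : 'I_v -> set R) : \bar R :=
  \int[lebesgue_measure_tuple v]_(x in tbox S) (W x)%:E.

Definition diag_cut_norm W : \bar R :=
  ereal_sup [set `|box_integral W (fun=> S)| |
    S in [set S | lebesgue_measurable S /\ S `<=` unit_itv]].

Definition cut_norm W : \bar R :=
  ereal_sup [set `|box_integral W S| |
    S in [set S : 'I_v -> set R |
      forall i, lebesgue_measurable (S i) /\ S i `<=` unit_itv]].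

End cut_norms.

(* Main.v *)
Require Import Defs.
From HB Require Import structures.
From mathcomp Require Import all_boot all_order all_algebra all_fingroup.
From mathcomp Require Import all_classical all_reals all_analysis.
From mathcomp Require Import measurable_realfun.

(* Let M(S_1, ..., S_v) be the integral of W over S_1 x ... x S_v, and let d be
   the diagonal cut norm. If the S_i are pairwise disjoint, polarization bounds
   |M(S_1, ..., S_v)| by 2^v d, since it writes v! M(S_1, ..., S_v) as a signed
   sum of M(U, ..., U) over the 2^v unions U of some of the S_i. This fails for
   overlapping sets, where, say, M(A, A, B) and M(A, B, B) can cancel. In that
   case cut [0, 1] into small cells, colour each cell with one of v colours, and
   replace S_i by its part of colour i. Averaging M over all colourings gives
   v^-v times the integral of W over the points of S_1 x ... x S_v whose
   coordinates lie in distinct cells; this integral is thus at most v^v 2^v d.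
   As the mesh tends to 0 it tends to M(S_1, ..., S_v), because the diagonals
   are null sets. *)

Set Implicit Arguments.
Unset Strict Implicit.
Unset Printing Implicit Defensive.
Import Order.TTheory GRing.Theory Num.Theory.
Import numFieldNormedType.Exports.
Local Open Scope classical_set_scope.
Local Open Scope ring_scope.

(** * Ryser's formula and counting colourings *)

(** Expand the product over i of 1 + G i, where G is 0 on B and -1 off B: choosing 1 exactly on T
    gives a nonzero term only if T contains B. The product vanishes as soon as some i lies outside
    B. *)
Lemma sum_sign_supersets (R : comPzRingType) (I : finType) (B : {set I}) :
  \sum_(T : {set I}) (-1) ^+ #|~: T| * (B \subset T)%:R =
  (B == [set: I]%SET)%:R :> R.
Proof.
pose G i : R := if i \in B then 0 else -1.
transitivity (\prod_(i : I) (1 + G i)).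
  rewrite bigA_distr; apply: eq_bigr => T _.
  rewrite (bigID (mem T))/= big1 ?mul1r; last by move=> i ->.
  have [BT|] := boolP (B \subset T).
    rewrite mulr1 -prodr_const; apply: eq_big => i; first by rewrite inE.
    rewrite inE /G => /negPf iT; rewrite iT; case: ifPn => // iB.
    by move: iT; rewrite (fintype.subsetP BT).
  move=> /fintype.subsetPn[i iB iT]; rewrite mulr0 (bigD1 i)//=.
  by rewrite (negPf iT) /G iB mul0r.
have [BT|] := eqVneq B [set: I]%SET.
  by rewrite big1// => i _; rewrite /G BT inE addr0.
rewrite -finset.subTset => /fintype.subsetPn[i _ iB].
by rewrite (bigD1 i)//= /G (negPf iB) subrr mul0r.
Qed.

(** Ryser's formula for the permanent. After expanding the products, each map f is weighted by the
    signed count of the sets T containing its image; this detects surjectivity, which is injectivity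
    here. *)
Lemma ryser_formula (R : comPzRingType) n (a : 'I_n -> 'I_n -> R) :
  \sum_(T : {set 'I_n}) (-1) ^+ #|~: T| * \prod_i \sum_(j in T) a i j =
  \sum_(f : {ffun 'I_n -> 'I_n} | injectiveb f) \prod_i a i (f i).
Proof.
under eq_bigr => T _.
  rewrite (bigA_distr_big (mem T) a)/= mulr_sumr big_mkcond/=.
  over.
rewrite exchange_big/= [RHS]big_mkcond/=; apply: eq_bigr => f _.
set B := [set f i | i in 'I_n]%SET.
transitivity ((\sum_(T : {set 'I_n}) (-1) ^+ #|~: T| * (B \subset T)%:R) *
  \prod_i a i (f i)).
  rewrite mulr_suml; apply: eq_bigr => T _.
  rewrite (_ : (f \in ffun_on _) = (B \subset T)).
    by case: ifP; rewrite ?mulr1 ?mulr0 ?mul0r.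
  apply/ffun_onP/fintype.subsetP => [fT _ /imsetP[i _ ->]|BT i].
    exact: fT.
  by apply: BT; exact: imset_f.
rewrite sum_sign_supersets.
suff -> : (B == [set: 'I_n]%SET) = injectiveb f.
  by case: ifP; rewrite ?mul1r ?mul0r.
rewrite eqEcard finset.subsetT/= cardsT.
apply/idP/injectiveP => [h|finj]; last by rewrite /B card_imset.
have /finset.imset_injP fi : #|B| == #|'I_n|.
  by rewrite eqn_leq h (leq_imset_card f)//.
by move=> x y; exact: fi.
Qed.

(** Colours are forced at the n points [k i] and free elsewhere, so the count is n ^ (#|K| - n); the
    factor n ^ n avoids the subtraction. *)
Lemma card_colourings n (K : finType) (k : 'I_n -> K) : injective k ->
  (#|[set g : {ffun K -> 'I_n} | [forall i, g (k i) == i]]%SET| * n ^ n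
   = n ^ #|K|)%N.
Proof.
(* [F x c] is 1 when no index i with [k i = x] demands a colour other than c, so the count is the
   product over x of the sums of [F x]. *)
move=> kinj; pose F x c := (\prod_(i | k i == x) (c == i : nat))%N.
have sumF x : (\sum_c F x c = if x \in codom k then 1 else n)%N.
  case: ifPn => [/codomP[i ->]|xk].
    have Fi c : F (k i) c = (c == i :> nat).
      rewrite /F (big_pred1 i)// => j.
      by rewrite /= (inj_eq kinj).
    under eq_bigr do rewrite Fi.
    rewrite (bigD1 i)//= eqxx big1// => c /negPf ci.
    exact: (congr1 nat_of_bool ci).
  rewrite (eq_bigr (fun=> 1%N)) ?sum1_card ?card_ord// => c _.
  rewrite /F big_pred0// => i; apply/negbTE; apply: contra xk => /eqP <-.
  exact: codom_f.
have -> : #|[set g : {ffun K -> 'I_n} | [forall i, g (k i) == i]]%SET| =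
    (\prod_x \sum_c F x c)%N.
  rewrite (bigA_distr_bigA F) -sum1_card big_mkcond/=; apply: eq_bigr => g _.
  rewrite inE; transitivity (\prod_i (g (k i) == i : nat))%N.
    case: ifPn => [/forallP gk|]; first by rewrite big1// => i _; rewrite gk.
    by rewrite negb_forall => /existsP[i /negPf gi]; rewrite (bigD1 i)//= gi.
  rewrite (partition_big k predT)//=; apply: eq_bigr => x _.
  by apply: eq_bigr => i /eqP ->.
have -> : (n ^ n = \prod_x if x \in codom k then n else 1)%N.
  rewrite -big_mkcond/= (eq_bigl (mem [set k i | i in 'I_n]%SET)); last first.
    move=> x; apply/codomP/imsetP => [[i ->]|[i _ ->]]; last by exists i.
    by exists i.
  rewrite big_imset/=; last by move=> ? ? _ _; exact: kinj.
  by rewrite prod_nat_const cardT size_enum_ord.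
rewrite -big_split/= -[RHS]prod_nat_const; apply: eq_bigr => x _.
by rewrite sumF; case: ifP; rewrite ?mul1n ?muln1.
Qed.

(** * Integrals of combinations of indicators *)

Lemma integrable_patch d (T : measurableType d) (R : realType)
    (mu : {measure set T -> \bar R}) (D A : set T) (f : T -> \bar R) :
  measurable D -> measurable A -> mu.-integrable D f ->
  mu.-integrable D (f \_ A).
Proof.
move=> mD mA intf; apply: le_integrable (intf) => //.
  apply/measurable_restrict => //.
  by apply: measurable_funS (measurable_int mu intf) => //; exact: subIsetl.
by move=> x _; rewrite patchE; case: ifP => // _; rewrite abse0.
Qed.

Lemma Rintegral_sum_indic d (T : measurableType d) (R : realType)
    (mu : {measure set T -> \bar R}) (D : set T) (f : T -> R)
    (I : finType) (c : I -> R) (A : I -> set T) :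
  measurable D -> mu.-integrable D (EFin \o f) ->
  (forall i, measurable (A i)) ->
  \sum_i c i * \int[mu]_(x in D `&` A i) f x =
  \int[mu]_(x in D) (\sum_i c i * \1_(A i) x * f x).
Proof.
move=> mD intf mA.
have intA i : mu.-integrable D (EFin \o (fun x => c i * \1_(A i) x * f x)).
  rewrite (_ : _ \o _ = (fun x => (c i)%:E * ((EFin \o f) \_ (A i)) x)%E).
    by apply: integrableZl => //; exact: integrable_patch.
  apply/funext => x /=; rewrite patchE indicE -mulrA.
  by case: (x \in A i); rewrite ?mul1r ?mul0r ?mulr0 ?mule0// EFinM.
(* Integrability of the partial sum is carried through the induction because additivity of the
   integral requires it. *)
have key (s : seq I) :
    mu.-integrable D
      (EFin \o (fun x => \sum_(i <- s) c i * \1_(A i) x * f x)) /\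
    \sum_(i <- s) c i * \int[mu]_(x in D `&` A i) f x =
    \int[mu]_(x in D) (\sum_(i <- s) c i * \1_(A i) x * f x).
  elim: s => [|i s [IHi IH]].
    split.
      rewrite (_ : _ \o _ = cst 0%E); first exact: integrable0.
      by apply/funext => x /=; rewrite big_nil.
    rewrite big_nil; under eq_Rintegral do rewrite big_nil.
    by rewrite Rintegral_cst// mul0r.
  split.
    rewrite (_ : _ \o _ = (fun x => (c i * \1_(A i) x * f x)%:E +
      (\sum_(i <- s) c i * \1_(A i) x * f x)%:E)%E).
      exact: integrableD (intA i) IHi.
    by apply/funext => x /=; rewrite big_cons EFinD.
  rewrite big_cons IH; under [RHS]eq_Rintegral do rewrite big_cons.
  rewrite RintegralD//; congr (_ + _).
  under [RHS]eq_Rintegral => x _ do rewrite -mulrA.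
  rewrite RintegralZl//.
    rewrite Rintegral_mkcondr; congr (_ * _); apply: eq_Rintegral => x _.
    by rewrite patchE indicE; case: (x \in A i); rewrite ?mul1r ?mul0r.
  rewrite (_ : _ \o _ = ((EFin \o f) \_ (A i))%E).
    exact: integrable_patch.
  apply/funext => x /=; rewrite patchE indicE.
  by case: (x \in A i); rewrite ?mul1r ?mul0r.
exact: (key (index_enum I)).2.
Qed.

(** Reduces a linear relation between integrals over different sets to a pointwise relation between
    indicators. Both the polarization and the averaging over colourings go through it. *)
Lemma eq_Rintegral_sum_indic d (T : measurableType d) (R : realType)
    (mu : {measure set T -> \bar R}) (D : set T) (f : T -> R)
    (I J : finType) (c : I -> R) (e : J -> R)
    (A : I -> set T) (B : J -> set T) :
  measurable D -> mu.-integrable D (EFin \o f) ->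
  (forall i, measurable (A i)) -> (forall j, measurable (B j)) ->
  (forall x, D x -> \sum_i c i * \1_(A i) x = \sum_j e j * \1_(B j) x) ->
  \sum_i c i * \int[mu]_(x in D `&` A i) f x =
  \sum_j e j * \int[mu]_(x in D `&` B j) f x.
Proof.
move=> mD intf mA mB AB; rewrite !Rintegral_sum_indic//.
by apply: eq_Rintegral => x /[!inE] Dx; rewrite -!mulr_suml AB.
Qed.

(** The image of mu under phi is mu, so the integral can be pulled back once f may be replaced by
    [f \o phi]. Invariance is assumed only almost everywhere on E, to suit symmetric elements of
    L^1. *)
Lemma integral_measure_preserving d (T : measurableType d) (R : realType)
    (mu : {measure set T -> \bar R}) (phi : T -> T) (E D : set T)
    (f : T -> \bar R) :
  measurable_fun setT phi ->
  (forall A, measurable A -> mu (phi @^-1` A) = mu A) ->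
  measurable E -> measurable D -> D `<=` E -> phi @^-1` D `<=` E ->
  mu.-integrable E f -> ae_eq mu E (f \o phi) f ->
  (\int[mu]_(x in phi @^-1` D) f x = \int[mu]_(x in D) f x)%E.
Proof.
move=> mphi muphi mE mD DE pDE intf fphi.
have mpD : measurable (phi @^-1` D).
  by rewrite -[X in measurable X]setTI; exact: mphi.
(* Extension by zero gives a function measurable on the whole space, as the pushforward formula
   requires; D and its preimage lie in E, so the integrals are unaffected. *)
pose g := f \_ E.
have mg : measurable_fun setT g.
  by apply: (measurable_int mu); exact: (integrable_mkcond f mE).1.
have gpf : ae_eq mu (phi @^-1` D) (g \o phi) f.
  apply: filterS fphi => x + Dx => /(_ (pDE _ Dx)) /= <-.
  by rewrite /g patchE mem_set//; exact: DE.
have intpf := integrableS mE mpD pDE intf.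
have /integrableP[mf fi] := intpf.
have mgp : measurable_fun (phi @^-1` D) (g \o phi).
  by apply: measurable_funTS; exact: measurableT_comp.
transitivity (\int[mu]_(x in phi @^-1` D) (g \o phi) x)%E.
  by apply: ae_eq_integral => //; exact: ae_eq_sym.
transitivity (\int[mu]_(x in D) g x)%E; last first.
  by apply: eq_integral => x /[!inE] Dx; rewrite /g patchE mem_set//; exact: DE.
rewrite -(integral_pushforward mphi mg)//; last first.
  apply/integrableP; split => //.
  rewrite (ae_eq_integral (abse \o f))//.
  - exact: measurableT_comp.
  - exact: measurableT_comp.
  - exact: ae_eq_abse.
apply: eq_measure_integral => // A mA _.
exact: muphi.
Qed.

(** * Permutation invariance of the product measure *)

Section permutation_invariance.
Context (R : realType) (n : nat).
Local Notation T := (n.-tuple (measurableTypeR R)).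
Local Notation tm := (tuple_measure (@lebesgue_measure R) n).
Local Notation cT := (caratheodory_type (tm^*)%mu).
Local Notation mu := (@lebesgue_measure_tuple R n).
Implicit Types s : 'S_n.

Lemma tuple_measurableE :
  (measurable : set (set T)) =
  <<s [set tbox S | S in [set S : 'I_n -> set (measurableTypeR R) |
        forall i, measurable (S i)]] >>.
Proof.
apply/seteqP; split; apply: smallest_sub.
- exact: smallest_sigma_algebra.
- move=> A; rewrite -bigcup_seq/= => -[i _ [B mB <-]].
  apply: sub_sigma_algebra; exists (fun j => if j == i then B else setT).
    by move=> j /=; case: ifP.
  apply/seteqP; split => x /=.
    by move=> Sx; split => //; have := Sx i; rewrite eqxx.
  by move=> [_ Bx] j; case: eqVneq => // ->.
- exact: sigma_algebra_measurable.
- by move=> A [S mS <-]; exact: measurable_tbox.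
Qed.

Lemma permute_argsK s : cancel (permute_args s) (permute_args s^-1%g : T -> T).
Proof.
by move=> x; apply: eq_from_tnth => i; rewrite !tnth_mktuple permKV.
Qed.

Lemma permute_argsVK s : cancel (permute_args s^-1%g) (permute_args s : T -> T).
Proof.
by move=> x; apply: eq_from_tnth => i; rewrite !tnth_mktuple permK.
Qed.

Lemma preimage_permute_tbox s (S : 'I_n -> set R) :
  permute_args s @^-1` tbox S = tbox (S \o s^-1%g).
Proof.
apply/seteqP; split => x /= Sx i.
  by have := Sx (s^-1%g i); rewrite tnth_mktuple permKV.
by rewrite tnth_mktuple; have := Sx (s i); rewrite /= permK.
Qed.

Lemma measurable_permute_args s :
  measurable_fun [set: T] (permute_args s : T -> T).
Proof.
apply/measurable_fun_tnthP => i.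
rewrite (_ : _ \o _ = fun x : T => tnth x (s i)); first exact: measurable_tnth.
by apply/funext => x /=; rewrite tnth_mktuple.
Qed.

(** Boxes generate the sigma-algebra and are stable under intersection, and permuting the sides
    preserves the product of their measures. Uniqueness of measures applies because the cubes
    [-k, k]^n have finite measure and exhaust the space. *)
Lemma tuple_measure_permute s (A : set T) : measurable A ->
  tm (permute_args s @^-1` A) = tm A.
Proof.
move=> mA; apply/esym.
rewrite -[RHS]/(pushforward tm (permute_args s : T -> T) A).
apply: (measure_unique
  [set tbox S | S in [set S : 'I_n -> set (measurableTypeR R) |
        forall i, measurable (S i)]]
  (fun k => tbox (fun=> `[- k%:R, k%:R]%classic))) => //.
- exact: tuple_measurableE.
- move=> _ _ [S mS <-] [S' mS' <-]; exists (fun i => S i `&` S' i).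
    by move=> i /=; exact: measurableI.
  apply/seteqP; split=> x /= => [Sx|[Sx Sx'] i]; last by split.
  by split=> i; have [] := Sx i.
- move=> k; exists (fun=> `[- k%:R, k%:R]%classic) => //.
- apply/seteqP; split => // x _.
  exists (\max_i Num.truncn `|tnth x i|).+1 => // i /=.
  rewrite in_itv/= -ler_norml; apply/ltW/(lt_le_trans (truncnS_gt _)).
  rewrite ler_nat ltnS.
  exact: (leq_bigmax (F := fun i => Num.truncn `|tnth x i|)).
- exact: measurable_permute_args.
- move=> mphi _ [S mS <-]; rewrite /= /pushforward preimage_permute_tbox.
  rewrite !tuple_measure_tbox//; last by move=> i; exact: mS.
  by rewrite (reindex_inj (@perm_inj _ s^-1%g)).
- move=> k.
  rewrite [ltLHS](tuple_measure_tbox (@lebesgue_measure R) (n := n)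
    (S := fun=> `[- k%:R, k%:R]%classic) (fun=> measurable_itv _)).
  suff fin : lebesgue_measure (`[- k%:R, k%:R]%classic : set R) \is a fin_num.
    by rewrite ltey_eq prode_fin_num.
  by rewrite lebesgue_measure_itv/=; case: ifP.
Qed.

(** A countable measurable cover pulls back to a cover of the preimage with the same total measure,
    which gives one inequality; the inverse permutation gives the other. *)
Lemma mu_ext_permute s (A : set T) :
  (tm^*)%mu (permute_args s @^-1` A) = (tm^*)%mu A.
Proof.
have le r (B : set T) : ((tm^*)%mu (permute_args r @^-1` B) <= (tm^*)%mu B)%E.
  apply: le_ereal_inf_tmp => _ [F [mF BF] <-].
  apply: ereal_inf_lbound; exists (fun k => permute_args r @^-1` F k).
    split => [k|x Bx].
      by rewrite -[X in measurable X]setTI; exact: measurable_permute_args.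
    by have [k _ Fk] := BF _ Bx; exists k.
  by apply: eq_eseriesr => k _; exact: tuple_measure_permute.
apply/eqP; rewrite eq_le le/=; apply: le_trans (le s^-1%g _).
apply: le_mu_ext => x Ax /=.
by rewrite permute_argsVK.
Qed.

(** Every test set X is itself a preimage under [permute_args s], so Caratheodory's condition is
    transported by the invariance of the outer measure. *)
Lemma caratheodory_measurable_permute s (A : set T) :
  caratheodory_measurable (tm^*)%mu A ->
  caratheodory_measurable (tm^*)%mu (permute_args s @^-1` A).
Proof.
move=> mA X.
have -> : X = permute_args s @^-1` (permute_args s^-1%g @^-1` X).
  by apply/seteqP; split => x /=; rewrite permute_argsK.
rewrite preimage_setC -!preimage_setI; set Y := _ @^-1` X.
by rewrite !mu_ext_permute -(mu_ext_permute s^-1%g X); exact: mA.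
Qed.

Lemma measurable_fun_permute_args s :
  measurable_fun [set: cT] (permute_args s : cT -> cT).
Proof.
by move=> _ A mA; rewrite setTI; exact: caratheodory_measurable_permute.
Qed.

Lemma measurable_cara_tbox (S : 'I_n -> set (measurableTypeR R)) :
  (forall i, measurable (S i)) -> measurable (tbox S : set cT).
Proof.
by move=> mS; apply: caratheodory_measurable_mu_ext; exact: measurable_tbox.
Qed.

Lemma measurable_unit_cube : measurable (@unit_cube R n : set cT).
Proof. by apply: measurable_cara_tbox => i; exact: measurable_itv. Qed.

Lemma integral_permute_args s (E D : set cT) (f : cT -> \bar R) :
  measurable E -> measurable D -> D `<=` E -> permute_args s @^-1` D `<=` E ->
  mu.-integrable E f -> ae_eq mu E (f \o permute_args s) f ->
  (\int[mu]_(x in permute_args s @^-1` D) f x = \int[mu]_(x in D) f x)%E.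
Proof.
apply: integral_measure_preserving; first exact: measurable_fun_permute_args.
by move=> A _; exact: mu_ext_permute.
Qed.

End permutation_invariance.

(** * Lebesgue measurable boxes *)

Lemma measurable_lebesgue_measurable (R : realType)
    (B : set (measurableTypeR R)) :
  measurable B -> lebesgue_measurable B.
Proof. by move=> mB; exact: sub_caratheodory. Qed.

(** Completion adjoins to each Borel set parts of null Borel sets. The measure of a box is computed
    from Borel sides, which is why Lebesgue measurable sides get replaced. *)
Lemma lebesgue_measurable_borel (R : realType) (S : set R) :
  lebesgue_measurable S -> exists B N : set (measurableTypeR R),
  [/\ measurable B, measurable N, lebesgue_measure N = 0%E, B `<=` S &
      S `\` B `<=` N].
Proof.
rewrite /lebesgue_measurable -completed_caratheodory_measurable.
rewrite g_sigma_completed_algebra_genE => -[B mB [M [N [mN N0 MN]] <-]].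
exists B, N; split => //.
by apply: subset_trans MN => x [[|]].
Qed.

Section null_sets.
Context (R : realType) (n : nat).
Local Notation T := (n.-tuple (measurableTypeR R)).
Local Notation tm := (tuple_measure (@lebesgue_measure R) n).
Local Notation cT := (caratheodory_type (tm^*)%mu).
Local Notation mu := (@lebesgue_measure_tuple R n).

Lemma negligible_tnth_preimage i (N : set (measurableTypeR R)) :
  measurable N -> lebesgue_measure N = 0%E ->
  mu.-negligible [set x : cT | N (tnth x i)].
Proof.
move=> mN N0; pose S j := if j == i then N else setT.
have mS j : measurable (S j) by rewrite /S; case: ifP.
exists (tbox S); split; first exact: measurable_cara_tbox.
  (* The remaining sides are whole lines of infinite measure; the convention 0 * +oo = 0 makes the
     product vanish. *)
  by rewrite lebesgue_measure_tuple_tbox// (bigD1 i)//= {1}/S eqxx N0 mul0e.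
by move=> x Nx j; rewrite /S; case: eqVneq => // ->.
Qed.

(** Shrinking each side to a Borel core removes only points with some coordinate in a null set,
    hence a negligible set. Completeness makes that set, and so the original box, measurable. *)
Lemma integral_tbox_borel (S : 'I_n -> set R) (f : cT -> \bar R) :
  mu.-integrable (@unit_cube R n : set cT) f ->
  (forall i, lebesgue_measurable (S i)) -> (forall i, S i `<=` @unit_itv R) ->
  exists2 B : 'I_n -> set (measurableTypeR R),
  (forall i, measurable (B i) /\ B i `<=` S i) &
  (\int[mu]_(x in tbox S) f x = \int[mu]_(x in tbox B) f x)%E.
Proof.
move=> intf mS SI.
have /choice[B] := fun i => lebesgue_measurable_borel (mS i).
move=> /choice[N BN]; exists B; first by move=> i; have [] := BN i.
have mB : measurable (tbox B : set cT).
  by apply: measurable_cara_tbox => i; have [] := BN i.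
have BS : tbox B `<=` tbox S.
  by move=> x Bx i; have [_ _ _ BS _] := BN i; apply: BS; exact: Bx.
pose M := tbox S `\` tbox B.
have negM : mu.-negligible M.
  have : mu.-negligible (\big[setU/set0]_(i < n) [set x : cT | N i (tnth x i)]).
    elim/big_ind : _ => [||i _].
    - exact: negligible_set0.
    - by move=> ? ?; exact: negligibleU.
    - by have [_ mN N0 _ _] := BN i; exact: negligible_tnth_preimage.
  apply: negligibleS => x [Sx /existsNP[i Bx]].
  rewrite -bigcup_seq; exists i => /=; first by rewrite mem_index_enum.
  by have [_ _ _ _] := BN i; apply; split; first exact: Sx.
have mM : measurable (M : set cT) by exact: lebesgue_measure_tuple_is_complete.
have SE : tbox S = tbox B `|` M by rewrite /M setDUK.
have mtS : measurable (tbox S : set cT) by rewrite SE; exact: measurableU.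
rewrite (negligible_integral mM mtS).
- by rewrite /M setDD setIidr.
- apply: integrableS intf => //; first exact: measurable_unit_cube.
  by move=> x Sx i; apply: SI; exact: Sx.
- exact: measure_negligible.
Qed.

End null_sets.

(** * Grids and diagonals *)

Section grid.
Context (R : realType).

(* [inord] is harmless: on [0, 1] the truncation is at most [N.+1]. *)
Definition grid_cell N (x : R) : 'I_N.+2 := inord (Num.truncn (N.+1%:R * x)).

(** Cells are half-open, so the endpoint 1 falls in the extra cell [N.+1], which meets [0, 1] only
    there; hence N + 2 cells of width 1 / (N + 1). *)
Lemma grid_cell_itv N (x : R) : unit_itv x ->
  (grid_cell N x)%:R / N.+1%:R <= x < (grid_cell N x).+1%:R / N.+1%:R.
Proof.
rewrite /unit_itv/= in_itv/= => /andP[x0 x1].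
have Nx0 : 0 <= N.+1%:R * x by rewrite mulr_ge0.
rewrite ler_pdivrMr// ltr_pdivlMr// !(mulrC x) /grid_cell inordK ?truncn_itv//.
rewrite ltnS -(ler_nat R) (le_trans _ (_ : N.+1%:R * x <= _))//.
  by rewrite truncn_le.
by rewrite ler_piMr.
Qed.

Lemma grid_cellP N k (x : R) : unit_itv x ->
  k%:R / N.+1%:R <= x < k.+1%:R / N.+1%:R -> grid_cell N x = k :> nat.
Proof.
move=> Ix; rewrite ler_pdivrMr// ltr_pdivlMr// !(mulrC x) => kx.
have := grid_cell_itv N Ix; rewrite ler_pdivrMr// ltr_pdivlMr// !(mulrC x).
by move=> /truncn_def <-; move: kx => /truncn_def <-.
Qed.

Lemma preimage_grid_cell N k :
  @unit_itv R `&` grid_cell N @^-1` [set k] =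
  @unit_itv R `&` `[k%:R / N.+1%:R, k.+1%:R / N.+1%:R[%classic.
Proof.
apply/seteqP; split => x [Ix] /=; rewrite in_itv/=.
  by move=> <-; split => //; exact: grid_cell_itv.
by move=> kx; split => //; apply/val_inj; exact: grid_cellP.
Qed.

Lemma measurable_grid_cell N k :
  measurable (@unit_itv R `&` grid_cell N @^-1` [set k]
    : set (measurableTypeR R)).
Proof.
by rewrite preimage_grid_cell; apply: measurableI; exact: measurable_itv.
Qed.

Lemma lebesgue_measure_grid_cell N k :
  (lebesgue_measure (@unit_itv R `&` grid_cell N @^-1` [set k]) <=
   N.+1%:R^-1%:E)%E.
Proof.
rewrite preimage_grid_cell.
apply: (@le_trans _ _ (lebesgue_measure
    (`[k%:R / N.+1%:R, k.+1%:R / N.+1%:R[%classic : set R))).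
  apply: le_measure; rewrite ?inE; last exact: subIsetr.
    by apply: measurableI; exact: measurable_itv.
  exact: measurable_itv.
rewrite lebesgue_measure_itv/=; case: ifP => _; last first.
  by rewrite lee_fin invr_ge0.
by rewrite -EFinB lee_fin -mulrBl -natrB// subSnn mul1r.
Qed.

Lemma grid_cell_eq_near N (x y : R) : unit_itv x -> unit_itv y ->
  grid_cell N x = grid_cell N y -> `|x - y| < N.+1%:R^-1.
Proof.
move=> /(grid_cell_itv N) + /(grid_cell_itv N) + xy; rewrite xy.
move: (nat_of_ord _) => k; rewrite -[k.+1%:R]natr1 mulrDl mul1r.
move=> /andP[x1 x2] /andP[y1 y2]; rewrite ltr_distl ltrBlDr.
by rewrite (lt_le_trans y2) ?lerD2r// (lt_le_trans x2)// lerD2r.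
Qed.

End grid.

Section distinct_cells.
Context (R : realType) (n : nat).
Local Notation T := (n.-tuple (measurableTypeR R)).
Local Notation tm := (tuple_measure (@lebesgue_measure R) n).
Local Notation cT := (caratheodory_type (tm^*)%mu).
Local Notation mu := (@lebesgue_measure_tuple R n).
Local Notation I_ := (@unit_itv R).
Local Notation cube := (@unit_cube R n).

Definition tuple_cells N (x : n.-tuple R) : {ffun 'I_n -> 'I_N.+2} :=
  [ffun i => grid_cell N (tnth x i)].

Lemma tbox_grid_cells N (P : pred {ffun 'I_n -> 'I_N.+2}) :
  cube `&` [set x | P (tuple_cells N x)] =
  \big[setU/set0]_(k | P k) tbox (fun i => I_ `&` grid_cell N @^-1` [set k i]).
Proof.
apply/seteqP; split => x.
  move=> [Ix Px]; rewrite -bigcup_seq_cond/=; exists (tuple_cells N x) => /=.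
    by rewrite mem_index_enum.
  by move=> i; split; [exact: Ix|rewrite /= ffunE].
rewrite -bigcup_seq_cond/= => -[k /= /andP[_ Pk] kx].
split; first by move=> i; have [] := kx i.
rewrite /= (_ : tuple_cells N x = k)//.
by apply/ffunP => i; rewrite ffunE; have [] := kx i.
Qed.

Lemma measurable_grid_cells N (P : pred {ffun 'I_n -> 'I_N.+2}) :
  measurable (cube `&` [set x | P (tuple_cells N x)] : set cT).
Proof.
rewrite tbox_grid_cells; apply: bigsetU_measurable => k _.
by apply: measurable_cara_tbox => i; exact: measurable_grid_cell.
Qed.

Lemma same_cell_bigsetU N (i j : 'I_n) :
  cube `&` [set x | tuple_cells N x i == tuple_cells N x j] `<=`
  \big[setU/set0]_(k < N.+2) tbox (fun l => I_ `&`
    (if l \in [:: i; j] then grid_cell N @^-1` [set inord k] else setT)).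
Proof.
move=> x [Ix /eqP]; rewrite !ffunE => xij.
rewrite -bigcup_seq/=; exists (grid_cell N (tnth x i)).
  by rewrite /= mem_index_enum.
move=> l; split; first exact: Ix.
by rewrite !inE inord_val; case: eqVneq => [->//|_]; case: eqVneq => [->/=|].
Qed.

(** The set is covered by N + 2 boxes, one per cell, each with two sides of length at most 1 / (N +
    1) and the others at most 1. The total (N + 2) / (N + 1)^2 is at most 2 / (N + 1). *)
Lemma measure_same_cell N (i j : 'I_n) : i != j ->
  (mu (cube `&` [set x | tuple_cells N x i == tuple_cells N x j]) <=
   (2 * N.+1%:R^-1)%:E)%E.
Proof.
move=> ij.
(* The index k is a natural number, read through [inord], because [Boole_inequality] expects a
   sequence of sets. *)
pose B (k : nat) : 'I_n -> set (measurableTypeR R) := fun l => I_ `&`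
    (if l \in [:: i; j] then grid_cell N @^-1` [set inord k] else setT).
have mB k l : measurable (B k l).
  rewrite /B; case: ifP => _; first exact: measurable_grid_cell.
  by rewrite setIT; exact: measurable_itv.
have mtB k : measurable (tbox (B k) : set cT) by exact: measurable_cara_tbox.
have B1 k l : (lebesgue_measure (B k l) <= 1)%E.
  apply: (@le_trans _ _ (lebesgue_measure (I_ : set (measurableTypeR R)))).
    apply: le_measure; rewrite ?inE//; last exact: subIsetl.
    exact: measurable_itv.
  by rewrite lebesgue_measure_itv/= lte_fin ltr01 oppr0 adde0.
have muB k : (mu (tbox (B k)) <= (N.+1%:R^-1 * N.+1%:R^-1)%:E)%E.
  rewrite lebesgue_measure_tuple_tbox// (bigD1 i)//= (bigD1 j) 1?eq_sym//=.
  rewrite muleA EFinM -[leRHS]mule1.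
  apply: lee_pmul.
  - exact: mule_ge0.
  - exact: prode_ge0.
  - apply: lee_pmul => //.
    + by rewrite /B !inE eqxx; exact: lebesgue_measure_grid_cell.
    + by rewrite /B !inE eqxx orbT; exact: lebesgue_measure_grid_cell.
  - suff /andP[] : (0 <= \prod_(l < n | (l != i) && (l != j))
        lebesgue_measure (B k l) <= 1)%E by [].
    apply: (big_ind (fun z => 0 <= z <= 1)%E)
      => [|x y /andP[x0 x1] /andP[y0 y1]|l _].
    + by rewrite lee01 lexx.
    + by rewrite mule_ge0//= -[leRHS]mule1 lee_pmul.
    + by rewrite B1 measure_ge0.
apply: (@le_trans _ _ (mu (\big[setU/set0]_(k < N.+2) tbox (B k)))).
  apply: le_measure; rewrite ?inE; last exact: same_cell_bigsetU.
  - exact: measurable_grid_cells (fun k => k i == k j).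
  - by apply: bigsetU_measurable => k _; exact: mtB.
apply: (@le_trans _ _ (\sum_(k < N.+2) mu (tbox (B k)))%E).
  apply: (@Boole_inequality _ _ _ mu (fun k => tbox (B k))) => k _; exact: mtB.
apply: (@le_trans _ _ (\sum_(k < N.+2) (N.+1%:R^-1 * N.+1%:R^-1)%:E)%E).
  exact: lee_sum.
rewrite sumEFin lee_fin sumr_const card_ord -[leLHS]mulr_natl mulrA.
rewrite ler_wpM2r ?invr_ge0// ler_pdivrMr// -natrM ler_nat.
by rewrite mul2n -addnn addnS ltnS leq_addr.
Qed.

(** Two equal coordinates share a cell of every grid, so the diagonal lies in the intersection over
    N of sets whose measure tends to 0. *)
Lemma negligible_diagonal (i j : 'I_n) : i != j ->
  mu.-negligible [set x : cT | cube x /\ tnth x i = tnth x j].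
Proof.
move=> ij.
pose E N := cube `&` [set x | tuple_cells N x i == tuple_cells N x j].
have mE N : measurable (E N : set cT).
  exact: measurable_grid_cells (fun k => k i == k j).
exists (\bigcap_N (E N)); split.
- exact: bigcapT_measurable.
- apply/eqP; rewrite eq_le measure_ge0 andbT.
  apply/lee_addgt0Pr => e e0; rewrite add0e.
  have e20 : 0 < e / 2 by rewrite divr_gt0.
  have [N _ /(_ N (leqnn _)) /= Ne] := near_infty_natSinv_lt (PosNum e20).
  apply: (@le_trans _ _ (mu (E N))).
    apply: le_measure; rewrite ?inE//; last by move=> x Ex; exact: Ex.
      exact: bigcapT_measurable.
    exact: mE.
  apply: (le_trans (measure_same_cell _ ij)); rewrite lee_fin.
  by rewrite mulrC -ler_pdivlMr// ltW.
- by move=> x [Ix xij] N _; split => //=; rewrite !ffunE xij.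
Qed.

End distinct_cells.

(** * Indicators of boxes and of disjoint unions *)

Lemma indic_tbox (R : realType) (T : Type) n (S : 'I_n -> set T)
    (x : n.-tuple T) :
  \1_(tbox S) x = \prod_i \1_(S i) (tnth x i) :> R.
Proof.
rewrite indicE; have [Sx|Sx] := pselect (tbox S x).
  by rewrite mem_set// big1// => i _; rewrite indicE mem_set.
rewrite memNset//; move/existsNP : Sx => [i Si].
by rewrite (bigD1 i)//= indicE memNset// mul0r.
Qed.

Lemma indic_bigsetU_disjoint (R : realType) (T : Type) (I : finType)
    (A : {set I}) (S : I -> set T) x :
  (forall i j x, S i x -> S j x -> i = j) ->
  \1_(\big[setU/set0]_(i in A) S i) x = \sum_(i in A) \1_(S i) x :> R.
Proof.
move=> dS; rewrite indicE.
have [[i iA Six]|nS] := pselect (exists2 i, i \in A & S i x).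
  rewrite mem_set; last first.
    by rewrite -bigcup_seq_cond; exists i => //=; rewrite mem_index_enum.
  rewrite (bigD1 i)//= indicE mem_set// big1 ?addr0// => j /andP[_ ji].
  by rewrite indicE memNset// => /dS -/(_ _ Six) jE; rewrite jE eqxx in ji.
rewrite memNset; last first.
  by rewrite -bigcup_seq_cond => -[i /= /andP[_ iA] Six]; apply: nS; exists i.
rewrite big1// => i iA; rewrite indicE memNset// => Six.
by apply: nS; exists i.
Qed.

(** * Convergence away from the diagonals *)

Section distinct_limit.
Context (R : realType) (n : nat).
Local Notation T := (n.-tuple (measurableTypeR R)).
Local Notation tm := (tuple_measure (@lebesgue_measure R) n).
Local Notation cT := (caratheodory_type (tm^*)%mu).
Local Notation mu := (@lebesgue_measure_tuple R n).
Local Notation cube := (@unit_cube R n).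

Definition distinct_cells N : set (n.-tuple R) :=
  cube `&` [set x | injectiveb (tuple_cells N x)].

Lemma measurable_distinct_cells N : measurable (distinct_cells N : set cT).
Proof. exact: (measurable_grid_cells (fun k => injectiveb k)). Qed.

(** Each of the finitely many pairs of coordinates is separated once the mesh drops below their
    distance. *)
Lemma near_distinct_cells (x : n.-tuple R) : cube x ->
  (forall i j, i != j -> tnth x i <> tnth x j) ->
  \forall N \near \oo, distinct_cells N x.
Proof.
move=> Ix xij.
have : \forall N \near \oo, forall p : 'I_n * 'I_n,
    p.1 != p.2 -> tuple_cells N x p.1 != tuple_cells N x p.2.
  apply: filter_forall => -[i j] /=; have [->|ij] := eqVneq i j.
    by apply: nearW => N; rewrite eqxx.
  have x0 : 0 < `|tnth x i - tnth x j|.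
    by rewrite normr_gt0 subr_eq0; apply/eqP; exact: xij.
  apply: filterS (near_infty_natSinv_lt (PosNum x0)) => N /= Nx _.
  apply/negP; rewrite !ffunE => /eqP.
  move=> /(grid_cell_eq_near (Ix i) (Ix j)) /(lt_trans Nx).
  by rewrite ltxx.
apply: filterS => N h; split => //=; apply/injectiveP => i j /eqP.
by have [//|/(h (i, j)) /negPf /= ->] := eqVneq i j.
Qed.

(** Dominated convergence with bound |f|: off the finitely many diagonals, which are negligible, the
    restricted integrands are eventually equal to f. *)
Lemma cvg_integral_distinct_cells (D : set cT) (f : cT -> \bar R) :
  measurable D -> D `<=` cube -> mu.-integrable D f ->
  (\int[mu]_(x in D `&` distinct_cells N) f x @[N --> \oo] -->
   \int[mu]_(x in D) f x)%E.
Proof.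
move=> mD DI intf.
under eq_fun do rewrite integral_mkcondr.
have mf := measurable_int mu intf.
have [] // := @dominated_convergence _ _ _ mu D mD
  (fun N => f \_ (distinct_cells N : set cT)) f (abse \o f).
- move=> N; apply/measurable_restrict => //.
    exact: measurable_distinct_cells.
  exact: measurable_funS mf.
- have : mu.-negligible (\big[setU/set0]_(p : 'I_n * 'I_n | p.1 != p.2)
      [set x : cT | cube x /\ tnth x p.1 = tnth x p.2]).
    elim/big_ind : _ => [||p]; first exact: negligible_set0.
      by move=> ? ?; exact: negligibleU.
    exact: negligible_diagonal.
  apply: negligibleS => x /=; apply: contra_notP => nd Dx.
  have /near_distinct_cells : forall i j, i != j -> tnth x i <> tnth x j.
    move=> i j ij xij; apply: nd; rewrite -bigcup_seq_cond.
    by exists (i, j); [rewrite /= mem_index_enum|split => //; exact: DI].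
  move=> /(_ (DI _ Dx)) xdist.
  apply: cvg_near_cst; apply: filterS xdist => N xN.
  by rewrite patchE mem_set.
- exact: integrable_abse.
- apply: aeW => x N _; rewrite patchE; case: ifP => // _.
  by rewrite abse0 abse_ge0.
Qed.

End distinct_limit.

(** * Bounds on box integrals *)

Section box_bounds.
Context (R : realType) (n : nat).
Local Notation T := (n.-tuple (measurableTypeR R)).
Local Notation tm := (tuple_measure (@lebesgue_measure R) n).
Local Notation cT := (caratheodory_type (tm^*)%mu).
Local Notation mu := (@lebesgue_measure_tuple R n).
Local Notation cube := (@unit_cube R n).
Implicit Types (W : cT -> R) (d : R) (S : 'I_n -> set (measurableTypeR R)).

(** Borel test sets suffice, since Lebesgue measurable sides are replaced by Borel ones beforehand.
    A real d keeps the estimates inside the field. *)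
Definition diag_bounded W d := forall A : set (measurableTypeR R),
  measurable A -> A `<=` @unit_itv R ->
  `|\int[mu]_(x in tbox (fun=> A)) W x| <= d.

Definition ae_symmetric W := forall s : 'S_n,
  ae_eq mu cube (EFin \o W \o permute_args s) (EFin \o W).

Lemma tbox_sub_cube S : (forall i, S i `<=` @unit_itv R) -> tbox S `<=` cube.
Proof. by move=> SI x Sx i; apply: SI; exact: Sx. Qed.

(** An injective self-map of a finite index set is a permutation, and permuting the sides of a box
    amounts to taking a preimage under a permutation of coordinates. *)
Lemma Rintegral_tbox_injective W S (f : {ffun 'I_n -> 'I_n}) :
  mu.-integrable cube (EFin \o W) -> ae_symmetric W ->
  (forall i, measurable (S i)) -> (forall i, S i `<=` @unit_itv R) ->
  injective f ->
  \int[mu]_(x in tbox (S \o f)) W x = \int[mu]_(x in tbox S) W x.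
Proof.
move=> intW symW mS SI finj; pose s := perm finj.
have -> : tbox (S \o f) = permute_args s^-1%g @^-1` tbox S.
  rewrite preimage_permute_tbox invgK; congr tbox.
  by apply/funext => i /=; rewrite permE.
congr fine; apply: (@integral_permute_args _ _ s^-1%g cube) => //.
- exact: measurable_unit_cube.
- exact: measurable_cara_tbox.
- exact: tbox_sub_cube.
- rewrite preimage_permute_tbox; apply: tbox_sub_cube => i; exact: SI.
Qed.

(** Integrate Ryser's formula for the matrix of entries 1_(S j)(x_i) against W. Disjointness makes
    the row sums over A the indicators of [U A]; on the other side every permutation contributes the
    same integral by symmetry. *)
Lemma Rintegral_disjoint_box_le W d S :
  mu.-integrable cube (EFin \o W) -> ae_symmetric W -> diag_bounded W d ->
  (forall i, measurable (S i)) -> (forall i, S i `<=` @unit_itv R) ->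
  (forall i j x, S i x -> S j x -> i = j) ->
  `|\int[mu]_(x in tbox S) W x| <= (2 ^ n)%:R * d.
Proof.
move=> intW symW Wd mS SI dS.
pose U (A : {set 'I_n}) := \big[setU/set0]_(i in A) S i.
have mU A : measurable (U A) by apply: bigsetU_measurable.
have UI A : U A `<=` @unit_itv R.
  by rewrite /U -bigcup_seq_cond => x [i _]; exact: SI.
have cubeI B : (forall i, B i `<=` @unit_itv R) -> cube `&` tbox B = tbox B.
  by move=> BI; apply/setIidr; exact: tbox_sub_cube.
(* This is n!, the number of permutations; the bound only needs c >= 1, witnessed by the
   identity. *)
pose c : R := \sum_(f : {ffun 'I_n -> 'I_n}) (injectiveb f)%:R.
have key : \sum_(A : {set 'I_n})
      (-1) ^+ #|~: A| * \int[mu]_(x in tbox (fun=> U A)) W x =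
    c * \int[mu]_(x in tbox S) W x.
  under eq_bigr do rewrite -(cubeI (fun=> U _))//.
  rewrite (@eq_Rintegral_sum_indic _ _ _ mu cube W _ _
    (fun A : {set 'I_n} => (-1) ^+ #|~: A|)
    (fun f : {ffun 'I_n -> 'I_n} => (injectiveb f)%:R)
    (fun A => tbox (fun=> U A)) (fun f => tbox (S \o f))
    (@measurable_unit_cube R n) intW).
  - rewrite mulr_suml; apply: eq_bigr => f _; rewrite cubeI; last first.
      by move=> i; exact: SI.
    case: injectiveP => [finj|]; rewrite ?mul0r// !mul1r.
    exact: Rintegral_tbox_injective.
  - by move=> A; exact: measurable_cara_tbox.
  - by move=> f; apply: measurable_cara_tbox => i; exact: mS.
  - move=> x _.
    under eq_bigr do rewrite indic_tbox.
    under [RHS]eq_bigr do rewrite indic_tbox.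
    under eq_bigr => A _ do
      under eq_bigr => i _ do rewrite indic_bigsetU_disjoint//.
    rewrite (ryser_formula (fun i j => \1_(S j) (tnth x i))) big_mkcond/=.
    by apply: eq_bigr => f _; case: ifP; rewrite ?mul1r ?mul0r.
have c1 : 1 <= c.
  rewrite /c (bigD1 ([ffun i => i] : {ffun 'I_n -> 'I_n}))//=.
  rewrite (_ : injectiveb _); last first.
    by apply/injectiveP => i j; rewrite !ffunE.
  by rewrite lerDl sumr_ge0.
apply: (@le_trans _ _ (c * `|\int[mu]_(x in tbox S) W x|)).
  by rewrite ler_peMl.
rewrite -[X in X * _]ger0_norm ?(le_trans _ c1)// -normrM -key.
apply: (le_trans (ler_norm_sum _ _ _)).
apply: (@le_trans _ _ (\sum_(A : {set 'I_n}) d)).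
  apply: ler_sum => A _; rewrite normrM normrX normrN1 expr1n mul1r.
  exact: Wd.
rewrite sumr_const -cardsT -powersetT card_powerset cardsT card_ord.
by rewrite -[leLHS]mulr_natl.
Qed.

(** For each colouring g the sets [Q g i] are disjoint, so the previous bound applies. Over all g,
    the boxes [tbox (Q g)] contain a point of [tbox S] exactly [c] times if its coordinates lie in
    distinct cells, and never otherwise. *)
Lemma Rintegral_distinct_cells_le W d S N : (0 < n)%N ->
  mu.-integrable cube (EFin \o W) -> ae_symmetric W -> diag_bounded W d ->
  (forall i, measurable (S i)) -> (forall i, S i `<=` @unit_itv R) ->
  `|\int[mu]_(x in tbox S `&` distinct_cells N) W x| <= (n ^ n * 2 ^ n)%:R * d.
Proof.
move=> n_gt0 intW symW Wd mS SI.
pose Q (g : {ffun 'I_N.+2 -> 'I_n}) i :=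
  S i `&` [set y | g (grid_cell N y) = i].
have QI g i : Q g i `<=` @unit_itv R by move=> x [/SI].
have mQ g i : measurable (Q g i : set (measurableTypeR R)).
  rewrite (_ : Q g i = \big[setU/set0]_(k | g k == i)
      (S i `&` (@unit_itv R `&` grid_cell N @^-1` [set k]))).
    apply: bigsetU_measurable => k _; apply: measurableI => //.
    exact: measurable_grid_cell.
  rewrite -bigcup_seq_cond; apply/seteqP; split => x.
    move=> [Sx gx]; exists (grid_cell N x).
      by rewrite /= mem_index_enum; apply/eqP.
    by split => //; split => //; exact: SI Sx.
  by move=> [k /= /andP[_ /eqP gk] [Sx [_ xk]]]; split => //=; rewrite xk.
have dQ g i j x : Q g i x -> Q g j x -> i = j by move=> [_ /= <-] [_ /= <-].
(* This is n ^ (N + 2 - n), the number of colourings prescribed on n distinct cells. If n > N + 2,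
   no n cells are distinct and only c > 0 matters. *)
pose c : R := (n ^ N.+2)%:R / (n ^ n)%:R.
have key : \sum_(g : {ffun 'I_N.+2 -> 'I_n}) \int[mu]_(x in tbox (Q g)) W x =
    c * \int[mu]_(x in tbox S `&` distinct_cells N) W x.
  transitivity (\sum_(g : {ffun 'I_N.+2 -> 'I_n})
      1 * \int[mu]_(x in cube `&` tbox (Q g)) W x).
    apply: eq_bigr => g _; rewrite mul1r setIidr//; exact: tbox_sub_cube.
  (* The single term on the right is presented as a sum over [unit]. *)
  rewrite (@eq_Rintegral_sum_indic _ _ _ mu cube W _ unit
    (fun=> 1) (fun=> c)
    (fun g => tbox (Q g)) (fun=> tbox S `&` distinct_cells N)
    (@measurable_unit_cube R n) intW).
  - rewrite big_const card_unit/= addr0 setIidr//.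
    by move=> x [_ []].
  - by move=> g; exact: measurable_cara_tbox.
  - move=> _; apply: measurableI; first exact: measurable_cara_tbox.
    exact: measurable_distinct_cells.
  move=> x Ix; rewrite big_const card_unit/= addr0.
  (* For x in [tbox S], [D g] says that x lies in [tbox (Q g)]. *)
  pose D (g : {ffun 'I_N.+2 -> 'I_n}) := [forall i, g (tuple_cells N x i) == i].
  transitivity (\1_(tbox S) x * \sum_(g | D g) 1 : R).
    rewrite mulr_sumr [RHS]big_mkcond/=; apply: eq_bigr => g _.
    rewrite mul1r !indicE; case: ifP => [/forallP Dg|/negP Dg].
      rewrite mulr1; congr (nat_of_bool _)%:R; apply/idP/idP; rewrite !inE.
        by move=> h i; have [] := h i.
      by move=> h i; split; [exact: h|have /eqP := Dg i; rewrite ffunE].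
    rewrite memNset// => h; apply: Dg; apply/forallP => i.
    by rewrite ffunE; apply/eqP; have [] := h i.
  rewrite !indicE in_setI -mulnb natrM mulrCA; congr (_ * _).
  (* Distinct cells are handled by [card_colourings]; a cell shared by two coordinates would need
     two colours, so no g fits. *)
  rewrite sumr_const; have [xinj|xinj] := boolP (injectiveb (tuple_cells N x)).
    have /injectiveP /card_colourings := xinj.
    rewrite card_ord cardsE => cE.
    rewrite mem_set// mulr1 /c -cE natrM mulfK// pnatr_eq0 -lt0n expn_gt0.
    by case: (n).
  rewrite memNset ?mulr0; last by move=> [_] /=; rewrite (negPf xinj).
  rewrite (_ : #|_| = 0%N)//; apply: eq_card0 => g; apply/negP => /forallP Dg.
  case/injectivePn : xinj => i [j ij xij]; move: ij.
  by rewrite -(eqP (Dg i)) xij (eqP (Dg j)) eqxx.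
have n0 : (n ^ n)%:R != 0 :> R by rewrite pnatr_eq0 -lt0n expn_gt0 n_gt0.
have c0 : 0 < c by rewrite divr_gt0// ltr0n expn_gt0 n_gt0.
rewrite -(ler_pM2l c0) -[X in X * `|_|]gtr0_norm// -normrM -key.
apply: (le_trans (ler_norm_sum _ _ _)).
apply: (@le_trans _ _ (\sum_(g : {ffun 'I_N.+2 -> 'I_n}) (2 ^ n)%:R * d)).
  by apply: ler_sum => g _; apply: Rintegral_disjoint_box_le => //; exact: dQ.
(* Dividing the n ^ (N + 2) colourings by [c] leaves n ^ n, so the bound is independent of N. *)
rewrite sumr_const card_ffun !card_ord -[leLHS]mulr_natl.
by rewrite [(n ^ n * _)%:R]natrM !mulrA /c mulfVK.
Qed.

(** The bound on points with distinct cells is uniform in N, so it passes to the limit. *)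
Lemma Rintegral_box_le W d S : (0 < n)%N ->
  mu.-integrable cube (EFin \o W) -> ae_symmetric W -> diag_bounded W d ->
  (forall i, measurable (S i)) -> (forall i, S i `<=` @unit_itv R) ->
  (`|\int[mu]_(x in tbox S) (W x)%:E| <= ((n ^ n * 2 ^ n)%:R * d)%:E)%E.
Proof.
move=> n_gt0 intW symW Wd mS SI.
have mtS : measurable (tbox S : set cT) by exact: measurable_cara_tbox.
have intS : mu.-integrable (tbox S) (EFin \o W).
  apply: integrableS intW => //; first exact: measurable_unit_cube.
  exact: tbox_sub_cube.
have cvgS := cvg_integral_distinct_cells mtS (tbox_sub_cube SI) intS.
have cvgabs :
  (`|\int[mu]_(x in tbox S `&` distinct_cells N) (W x)%:E| @[N --> \oo] -->
    `|\int[mu]_(x in tbox S) (W x)%:E|)%E by exact: cvg_abse.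
rewrite -(cvg_lim _ cvgabs)//; apply: lime_le.
  by apply/cvg_ex; eexists; exact: cvgabs.
apply: nearW => N; rewrite -EFin_normr_Rintegral//.
- by rewrite lee_fin; exact: Rintegral_distinct_cells_le.
- by apply: measurableI => //; exact: measurable_distinct_cells.
- apply: integrableS intS => //.
  by apply: measurableI => //; exact: measurable_distinct_cells.
Qed.

End box_bounds.

(** * Comparison of the two cut norms *)

Theorem lemma2p1 (R : realType) (v : nat) (hv : (2 <= v)%N) :
  exists2 C : R, 0 < C & forall W : v.-tuple R -> R, symmetric_L1 W ->
    (C%:E * cut_norm W <= diag_cut_norm W)%E /\
    (diag_cut_norm W <= cut_norm W)%E.
Proof.
have v_gt0 : (0 < v)%N by exact: leq_trans hv.
pose K : R := (v ^ v * 2 ^ v)%:R.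
have K_gt0 : 0 < K by rewrite ltr0n muln_gt0 !expn_gt0 v_gt0.
exists K^-1; first by rewrite invr_gt0.
move=> W [intW symW]; split; last first.
  apply: ge_ereal_sup => _ [S [mS SI] <-].
  by apply: ereal_sup_ubound; exists (fun=> S).
have symW' : ae_symmetric W.
  move=> s; apply: negligibleS (symW s) => x /=.
  by apply: contra_not => h /h /= ->.
have diagP A : lebesgue_measurable A -> A `<=` @unit_itv R ->
    (`|box_integral W (fun=> A)| <= diag_cut_norm W)%E.
  by move=> mA AI; apply: ereal_sup_ubound; exists A.
(* The value +oo makes the claim trivial, and -oo is excluded by testing the empty set. *)
case E : (diag_cut_norm W) => [r| |]; last 2 first.
- by rewrite leey.
- have /diagP : lebesgue_measurable (set0 : set R) by exact: measurable0.
  move=> /(_ (@sub0set _ _)); rewrite E.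
  by move=> /(le_trans (abse_ge0 _)).
have Wr : diag_bounded W r.
  move=> A mA AI.
  have := diagP _ (measurable_lebesgue_measurable mA) AI.
  rewrite E /box_integral.
  rewrite -EFin_normr_Rintegral ?lee_fin//.
    by apply: measurable_cara_tbox.
  apply: integrableS intW; first exact: measurable_unit_cube.
    by apply: measurable_cara_tbox.
  exact: tbox_sub_cube.
rewrite -lee_pdivlMl ?invr_gt0// invrK -EFinM.
apply: ge_ereal_sup => _ [S SP <-].
have mS i : lebesgue_measurable (S i) by have [] := SP i.
have SI i : S i `<=` @unit_itv R by have [] := SP i.
(* The sides become Borel without changing the integral, so that the bound for Borel boxes
   applies. *)
rewrite /box_integral; have [B BP ->] := integral_tbox_borel intW mS SI.
apply: Rintegral_box_le => //.
- by move=> i; have [] := BP i.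
- by move=> i; apply: subset_trans (SI i); have [] := BP i.
Qed.
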